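(* Let $\mathcal{E}$ be an evolution algebra over $\mathbb{K}$ that is either almost abelian or satisfies $\operatorname{supp}\big(\operatorname{SNil}(\mathcal{E})\big)=\operatorname{supp}(\mathcal{E})$. If $\mathcal{E}$ is dually atomistic, then it is isomorphic to one of the following pairwise non-isomorphic almost abelian evolution algebras: - $\mathcal{E}_2(1,-1)$: the algebra with natural basis $\{e_1,e_2\}$ and $e_1^2=-e_2^2=e_1+e_2$; - $\mathcal{E}_{n,1}$, with $n\in\mathbb{N}$: the algebra with natural basis $\{e_1,\dots,e_n\}$ and $e_1^2=e_1$, $e_2^2=\dots=e_n^2=0$.
   Context: $\mathbb{K}$ is a field of characteristic different from $2$. An evolution algebra over $\mathbb{K}$ is a finite-dimensional $\mathbb{K}$-algebra (commutative, not necessarily associative) having a basis $B=\{e_1,\dots,e_n\}$, called a natural basis, with $e_ie_j=0$ for $i\neq j$; a natural basis of $\mathcal{E}$ is fixed. For $u=\sum\mu_ie_i$, $\operatorname{supp}(u)=\{i:\mu_i\neq0\}$, and for a subspace $U$, $\operatorname{supp}(U)=\bigcup_{u\in U}\operatorname{supp}(u)$. An algebra $\mathcal{A}$ (or ideal) is abelian if $\mathcal{A}^2=0$. An evolution algebra is almost abelian if it is nonabelian but has an abelian ideal of codimension one. For an algebra $\mathcal{A}$ put $\mathcal{A}^1=\mathcal{A}$, $\mathcal{A}^{m+1}=\sum_{i=1}^m\mathcal{A}^i\mathcal{A}^{m+1-i}$; $\mathcal{A}$ is nilpotent if $\mathcal{A}^m=0$ for some $m$; an ideal is nilpotent if it is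 so as an algebra. An ideal $I$ of $\mathcal{E}$ is $\mathcal{E}$-supersolvable if there is a chain $0=I_0\subsetneq I_1\subsetneq\dots\subsetneq I_s=I$ with each $I_i$ an ideal of $\mathcal{E}$ and $\dim I_i=i$. The supersolvable nilradical $\operatorname{SNil}(\mathcal{E})$ is the largest $\mathcal{E}$-supersolvable nilpotent ideal of $\mathcal{E}$ (a largest such ideal exists). $\mathcal{E}$ is dually atomistic if every proper subalgebra of $\mathcal{E}$ is an intersection of maximal subalgebras of $\mathcal{E}$.
   Formalization: The evolution algebra is additionally assumed nonabelian: an abelian one, e.g. e_1^2=0 in dimension one, has SNil(E)=E and is dually atomistic, but is isomorphic to none of the listed algebras. *)

(* Defs.v *)
From HB Require Import structures.
From mathcomp Require Import all_boot all_order all_algebra.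

Set Implicit Arguments.
Unset Strict Implicit.
Unset Printing Implicit Defensive.

Import GRing.Theory.
Local Open Scope ring_scope.

(* Neither associativity nor a unit is required of an algebra. *)
Record commAlg (K : fieldType) := CommAlg {
  alg_car :> vectType K;
  amul : {bilinear alg_car -> alg_car -> alg_car};
  amulC : forall u v, amul u v = amul v u
}.

Record evolAlg (K : fieldType) := EvolAlg {
  evol_alg :> commAlg K;
  edim : nat;
  nbasis : edim.-tuple evol_alg;
  nbasisP : basis_of fullv nbasis;
  nbasis_orth : forall i j : 'I_edim, i != j ->
    amul evol_alg (tnth nbasis i) (tnth nbasis j) = 0
}.

Definition alg_isom (K : fieldType) (A B : commAlg K) : Prop :=
  exists f : {linear A -> B},
    bijective f /\ forall u v, f (amul A u v) = amul B (f u) (f v).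

Section Algebra.
Variables (K : fieldType) (A : commAlg K).
Implicit Types (U V W I J M : {vspace A}).

Definition amulv U V : {vspace A} :=
  <<[seq amul A u v | u <- vbasis U, v <- vbasis V]>>%VS.

Lemma amulvP U V W :
  reflect (forall u v, u \in U -> v \in V -> amul A u v \in W)
          (amulv U V <= W)%VS.
Proof.
apply: (iffP idP) => [sUVW u v /coord_vbasis-> /coord_vbasis-> | sUVW].
  rewrite linear_sumlz memv_suml // => i _; rewrite linearZl_LR memvZ //.
  rewrite linear_sumr memv_suml // => j _; rewrite linearZr_LR memvZ //.
  apply: (subvP sUVW); apply: memv_span; apply/allpairsP.
  by exists ((vbasis U)`_i, (vbasis V)`_j); rewrite !mem_nth ?size_tuple.
apply/span_subvP=> _ /allpairsP[[u v] /= [Uu Vv ->]].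
by rewrite sUVW ?vbasis_mem.
Qed.

Definition subalgebra U : Prop := (amulv U U <= U)%VS.

Definition alg_ideal I : Prop := (amulv fullv I <= I)%VS.

Definition abelian_sub U : Prop := amulv U U = 0%VS.

(* The list [:: U^1; ...; U^m.+1] of the principal powers. *)
Fixpoint apow_seq U (m : nat) : seq {vspace A} :=
  if m is m'.+1 then
    let s := apow_seq U m' in
    rcons s (\sum_(i < m) amulv (nth 0 s i) (nth 0 s (m' - i)))%VS
  else [:: U].

(* apow U m is U^m for m > 0 (apow U 0 is a dummy value). *)
Definition apow U (m : nat) : {vspace A} := nth 0%VS (apow_seq U m.-1) m.-1.

Lemma size_apow_seq U m : size (apow_seq U m) = m.+1.
Proof. by elim: m => //= m IHm; rewrite size_rcons IHm. Qed.

Lemma nth_apow_seq U m i : (i <= m)%N -> nth 0%VS (apow_seq U m) i = apow U i.+1.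
Proof.
elim: m => [|m IHm]; first by rewrite leqn0 => /eqP->.
rewrite leq_eqVlt => /orP[/eqP-> // | lt_im].
by rewrite /= nth_rcons size_apow_seq lt_im IHm.
Qed.

Lemma apow1 U : apow U 1 = U. Proof. by []. Qed.

Lemma apowS U m : (0 < m)%N ->
  apow U m.+1 = (\sum_(1 <= i < m.+1) amulv (apow U i) (apow U (m.+1 - i)))%VS.
Proof.
case: m => // m _.
rewrite {1}/apow /= nth_rcons size_apow_seq ltnn eqxx big_add1 /= big_mkord.
apply: eq_bigr => i _; have lt_im := ltn_ord i.
by rewrite !nth_apow_seq ?leq_subr // subSS subSn.
Qed.

Definition nilpotent_sub U : Prop := exists m, (0 < m)%N /\ apow U m = 0%VS.

Definition supersolvable_ideal I : Prop :=
  alg_ideal I /\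
  exists (s : nat) (c : nat -> {vspace A}),
    [/\ c 0%N = 0%VS, c s = I,
        forall i, (i <= s)%N -> alg_ideal (c i) /\ \dim (c i) = i
      & forall i, (i < s)%N -> (c i <= c i.+1)%VS /\ c i <> c i.+1].

Definition SNil_cand I : Prop :=
  supersolvable_ideal I /\ nilpotent_sub I.

Definition is_SNil N : Prop :=
  SNil_cand N /\ forall J, SNil_cand J -> (J <= N)%VS.

Definition almost_abelian : Prop :=
  ~ abelian_sub fullv /\
  exists I, [/\ alg_ideal I, abelian_sub I & (\dim I).+1 = \dim {:A}].

Definition maximal_subalgebra M : Prop :=
  [/\ subalgebra M, M <> fullv
    & forall U, subalgebra U -> (M <= U)%VS -> U = M \/ U = fullv].

Definition dually_atomistic : Prop :=
  forall U, subalgebra U -> U <> fullv ->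
  exists F : {vspace A} -> Prop,
    (forall M, F M -> maximal_subalgebra M) /\
    (forall x, x \in U <-> forall M, F M -> x \in M).

End Algebra.

Arguments almost_abelian {K} A.
Arguments dually_atomistic {K} A.

Definition supp (K : fieldType) (E : evolAlg K) (u : E) : {set 'I_(edim E)} :=
  [set i | coord (nbasis E) i u != 0].

Definition supp_sub (K : fieldType) (E : evolAlg K) (U : {vspace E})
    (i : 'I_(edim E)) : Prop :=
  exists2 u, u \in U & i \in supp u.

(* The evolution algebra on 'rV[K]_n whose natural basis is the canonical one
   and whose structure matrix is M: the square of the i-th basis vector is
   the i-th row of M. *)
Section OfMatrix.
Variables (K : fieldType) (n : nat) (M : 'M[K]_n).

Definition mx_emul (u v : 'rV[K]_n) : 'rV[K]_n :=
  (\row_i (u 0 i * v 0 i)) *m M.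

Lemma mx_emul_bilinear : bilinear_for *:%R *:%R mx_emul.
Proof.
split=> [v a x y | u a x y]; rewrite /= /applyr /mx_emul scalemxAl -mulmxDl;
  congr (_ *m _); apply/rowP=> i; rewrite !mxE.
  by rewrite mulrDl mulrA.
by rewrite mulrDr mulrCA.
Qed.

HB.instance Definition _ := bilinear_isBilinear.Build K
  'rV[K]_n 'rV[K]_n 'rV[K]_n *:%R *:%R mx_emul mx_emul_bilinear.

Lemma mx_emulC u v : mx_emul u v = mx_emul v u.
Proof.
by rewrite /mx_emul; congr (_ *m _); apply/rowP=> i; rewrite !mxE mulrC.
Qed.

Definition mx_commAlg : commAlg K := @CommAlg K 'rV[K]_n mx_emul mx_emulC.

Definition mx_nbasis : n.-tuple mx_commAlg :=
  [tuple (delta_mx 0 i : 'rV[K]_n) | i < n].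

Lemma mx_nbasisP : basis_of fullv mx_nbasis.
Proof.
rewrite basisEdim size_tuple dimvf /dim /= mul1n leqnn andbT.
apply/subvP=> u _; rewrite [u]row_sum_delta memv_suml // => i _.
by rewrite memvZ // memv_span // -(tnth_mktuple (delta_mx 0) i) mem_tnth.
Qed.

Lemma mx_nbasis_sqr i : mx_emul (tnth mx_nbasis i) (tnth mx_nbasis i) = row i M.
Proof.
rewrite tnth_mktuple rowE /mx_emul; congr (_ *m _).
by apply/rowP=> j; rewrite !mxE -natrM mulnb andbb.
Qed.

Lemma mx_nbasis_orth i j : i != j ->
  mx_emul (tnth mx_nbasis i) (tnth mx_nbasis j) = 0.
Proof.
move=> neq_ij; rewrite !tnth_mktuple /mx_emul.
rewrite (_ : \row_k _ = 0) ?mul0mx //; apply/rowP=> k; rewrite !mxE -natrM mulnb /=.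
by case: eqP => //= ->; rewrite (negPf neq_ij).
Qed.

Definition mx_evolAlg : evolAlg K :=
  @EvolAlg K mx_commAlg n mx_nbasis mx_nbasisP mx_nbasis_orth.

End OfMatrix.

(* e_1^2 = e_1 + e_2 and e_2^2 = - e_1 - e_2. *)
Definition E2_1N1 (K : fieldType) : evolAlg K :=
  mx_evolAlg (\matrix_(i < 2, j < 2) (if i == 0 then 1 else -1 : K)).

(* Indices start at 0: only the first basis vector has a nonzero square,
   equal to itself. Meaningful for 0 < n only. *)
Definition En1 (K : fieldType) (n : nat) : evolAlg K :=
  mx_evolAlg (\matrix_(i < n, j < n)
                (((i : nat) == 0) && ((j : nat) == 0))%:R : 'M[K]_n).

(* Main.v *)
Require Import Defs.
From HB Require Import structures.
From mathcomp Require Import all_boot all_order all_algebra.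

Set Implicit Arguments.
Unset Strict Implicit.
Unset Printing Implicit Defensive.

Import GRing.Theory.
Local Open Scope ring_scope.

(* Let [E] be dually atomistic. If [J] is a proper abelian ideal, each [x] acts
   on [J] as a scalar, because every line of [J] is an intersection of maximal
   subalgebras, each of which contains or supplements [J].

   The supersolvable nilradical [N] satisfies [N ^ 2 <= M] for every maximal
   subalgebra [M], hence is abelian, as the maximal subalgebras meet in [0]. If
   [N] has full support, [u] in [N] with [i] in its support gives
   [e_i u = u_i e_i ^ 2], a scalar multiple of [u]; this forces [N] to be a
   line containing [E ^ 2], and then [E] to be of dimension two, with [N] as an
   abelian ideal of codimension one.

   If [E = I + K x] with [I] an abelian ideal of codimension one, then after
   scaling [x] acts on [I] as [0] or [1]. The first case yields the algebras
   E_(n,1); in the second one, if [I] is nonzero, the orthogonality of the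
   natural basis leaves only E_2(1,-1). *)

Local Notation "u ** v" := (amul _ u v) (at level 40, left associativity).

(** * Lines, hyperplanes and endomorphisms that stabilize every line *)

Section VectorSpaces.
Variables (K : fieldType) (V : vectType K).
Implicit Types (U W J : {vspace V}) (u v w : V).

Lemma dim_addv_line U v : v \notin U -> (\dim U < \dim (U + <[v]>))%N.
Proof.
move=> U'v; rewrite ltn_neqAle (dimv_leqif_eq (addvSl _ _)).2 dimvS ?addvSl //=.
rewrite andbT; apply: contra U'v => /eqP->.
by rewrite (subvP (addvSr _ _)) ?memv_line.
Qed.

Lemma addv_line U W v : (U <= W)%VS -> \dim W = (\dim U).+1 ->
  v \in W -> v \notin U -> (U + <[v]>)%VS = W.
Proof.
move=> sUW dimW Wv U'v; apply/eqP; rewrite eqEdim subv_add sUW -memvE Wv dimW.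
exact: dim_addv_line.
Qed.

Lemma mem_addv_line U v w : w \in (U + <[v]>)%VS ->
  exists2 u, u \in U & exists a, w = u + a *: v.
Proof.
by case/memv_addP=> u Uu [_ /vlineP[a ->] ->]; exists u => //; exists a.
Qed.

(** The factors of [u], of a fixed [v] in [J] and of [u + v] are compared; they agree when [u] and
    [v] are independent. *)
Lemma scalar_on_lines (f : {linear V -> V}) J :
    (forall u, u \in J -> f u \in <[u]>%VS) ->
  exists c, forall u, u \in J -> f u = c *: u.
Proof.
move=> fJ; have Jv := memv_pick J; set v := vpick J in Jv.
have /vlineP[c fv] := fJ _ Jv; exists c => u Ju.
have [/vlineP[a ->] | v'u] := boolP (u \in <[v]>%VS).
  by rewrite linearZ fv /= !scalerA mulrC.
have /vlineP[a fu] := fJ _ Ju; have /vlineP[b fuv] := fJ _ (rpredD Ju Jv).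
have Duv : (b - a) *: u = (c - b) *: v.
  apply/eqP; rewrite !scalerBl subr_eq addrAC -fv eq_sym subr_eq -scalerDr.
  by rewrite -fuv linearD /= fu addrC.
have [ba | nba] := eqVneq (b - a) 0; last first.
  case/vlineP: v'u; exists ((b - a)^-1 * (c - b)).
  by rewrite -scalerA -Duv scalerA mulVf ?scale1r.
move/eqP: Duv; rewrite ba scale0r eq_sym scaler_eq0 vpick0.
have -> : b = a by apply/eqP; rewrite -subr_eq0 ba.
case/orP=> [|/eqP J0]; first by rewrite subr_eq0 => /eqP->.
by move: Ju; rewrite J0 memv0 => /eqP->; rewrite linear0 scaler0.
Qed.

End VectorSpaces.

(** * Subalgebras, ideals and maximal subalgebras of a commutative algebra *)

Section Algebra.
Variables (K : fieldType) (A : commAlg K).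
Implicit Types (U N I J M : {vspace A}) (u v w x : A).

Lemma subalgebraP U :
  subalgebra U <-> forall u v, u \in U -> v \in U -> u ** v \in U.
Proof. by split=> [/amulvP | ?]; last apply/amulvP. Qed.

Lemma alg_idealP I : alg_ideal I <-> forall u v, v \in I -> u ** v \in I.
Proof.
split=> [/amulvP sI u v|sI]; first by apply: sI; rewrite memvf.
by apply/amulvP=> u v _; apply: sI.
Qed.

Lemma abelian_subP U :
  abelian_sub U <-> forall u v, u \in U -> v \in U -> u ** v = 0.
Proof.
split=> [U0 u v Uu Uv | U0].
  by apply/eqP; rewrite -memv0; apply: (amulvP _ _ _ _) Uu Uv; rewrite U0.
by apply/eqP; rewrite -subv0; apply/amulvP=> u v Uu Uv; rewrite U0 ?mem0v.
Qed.

Lemma ideal_subalgebra I : alg_ideal I -> subalgebra I.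
Proof. by move=> /alg_idealP idI; apply/subalgebraP=> u v _; apply: idI. Qed.

(** The ideal [J] absorbs the cross terms, so [M + J] is a subalgebra strictly above [M]. *)
Lemma maximal_add_ideal M J : maximal_subalgebra M -> alg_ideal J ->
  ~~ (J <= M)%VS -> (M + J)%VS = fullv.
Proof.
case=> /subalgebraP algM _ maxM /alg_idealP idJ nJM.
have algMJ : subalgebra (M + J)%VS.
  apply/subalgebraP=> _ v /memv_addP[m Mm [j Jj ->]].
  case/memv_addP=> m' Mm' [j' Jj' ->].
  rewrite linearDr linearDl /= -addrA; apply: memv_add; first exact: algM.
  by rewrite rpredD 1?(amulC j) ?idJ.
case: (maxM _ algMJ (addvSl _ _)) => // defM.
by rewrite -defM addvSr in nJM.
Qed.

(** Dual atomisticity in the form used below; for [U] zero it says that the maximal subalgebras meet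
    in 0. *)
Lemma dually_atomistic_mem U x : dually_atomistic A -> subalgebra U ->
    U <> fullv ->
    (forall M, maximal_subalgebra M -> (U <= M)%VS -> x \in M) ->
  x \in U.
Proof.
move=> daA algU nU maxx; have [F [maxF FU]] := daA U algU nU.
apply/FU=> M FM; apply: maxx; first exact: maxF.
by apply/subvP=> u /FU; apply.
Qed.

Lemma subalgebra0 : subalgebra (0%VS : {vspace A}).
Proof.
by apply/subalgebraP=> u v; rewrite !memv0 => /eqP-> _; rewrite linear0l.
Qed.

(* A maximal subalgebra [M] not containing [J] supplements [J], so [J] being
   abelian makes [M :&: J] an ideal; thus every subspace of [J], being an
   intersection of such, is an ideal. *)
Lemma abelian_ideal_scalar J x : dually_atomistic A -> alg_ideal J ->
    abelian_sub J -> J <> fullv ->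
  exists c, forall u, u \in J -> x ** u = c *: u.
Proof.
move=> daA idJ /abelian_subP abJ nJ; apply: scalar_on_lines => u Ju /=.
apply: dually_atomistic_mem => //.
- apply/subalgebraP=> _ _ /vlineP[a ->] /vlineP[b ->].
  by rewrite abJ ?mem0v // rpredZ.
- move=> fu; apply: nJ; apply/eqP; rewrite eqEsubv subvf -fu -memvE.
  exact: Ju.
move=> M maxM; rewrite -memvE => Mu; case: (boolP (J <= M)%VS) => [sJM | nJM].
  by apply: (subvP sJM); move/alg_idealP: idJ; apply.
have: x \in (M + J)%VS by rewrite maximal_add_ideal ?memvf.
(* As [j ** u = 0], the product [x ** u] is [m ** u], with both factors in [M]. *)
case/memv_addP=> m Mm [j Jj ->]; rewrite linearDl /= (abJ j) ?addr0 //.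
by case: maxM => /subalgebraP algM _ _; apply: algM.
Qed.

Lemma amulv_apow U k : (0 < k)%N -> (amulv U (apow U k) <= apow U k.+1)%VS.
Proof. by move=> k_gt0; rewrite apowS // big_ltn // subn1 addvSl. Qed.

(* If [n ** w] were not in [J], it would generate [J'] modulo [J], so that
   [w = c *: (n ** w)] modulo [J]; iterating, [w] is in all [N ^ k + J]. *)
Lemma nilpotent_chief_factor N J J' n w : nilpotent_sub N -> alg_ideal J ->
    alg_ideal J' -> (J <= J')%VS -> (J' <= N)%VS -> \dim J' = (\dim J).+1 ->
  n \in N -> w \in J' -> n ** w \in J.
Proof.
case=> m [m_gt0 Nm0] /alg_idealP idJ /alg_idealP idJ' sJJ' sJ'N dimJ' Nn J'w.
have [// | J'nw] := boolP (n ** w \in J).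
have: w \in (J + <[n ** w]>)%VS by rewrite (addv_line sJJ') ?idJ'.
case/memv_addP=> j Jj [_ /vlineP[c ->] def_w].
suff w_in k : (0 < k)%N -> w \in (apow N k + J)%VS.
  by case/negP: J'nw; apply: idJ; have := w_in m m_gt0; rewrite Nm0 add0v.
case: k => // k _; elim: k => [|k /memv_addP[a Na [b Jb defw2]]].
  by rewrite (subvP (addvSl _ _)) ?(subvP sJ'N).
rewrite def_w defw2 linearDr /= scalerDr addrCA memv_add //.
  by rewrite rpredZ //; apply: (amulvP _ _ _ (amulv_apow N (ltn0Sn k))).
by rewrite rpredD // rpredZ ?idJ.
Qed.

Lemma chain_sub (c : nat -> {vspace A}) s i :
    (forall i, (i < s)%N -> (c i <= c i.+1)%VS) -> (i <= s)%N ->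
  (c i <= c s)%VS.
Proof.
move=> cS; elim: s cS => [|s IHs] cS; first by rewrite leqn0 => /eqP->.
rewrite leq_eqVlt => /orP[/eqP-> // | lt_is].
apply: subv_trans (cS s (ltnSn s)); apply: IHs lt_is => j ltjs.
by apply: cS; apply: ltnW.
Qed.

(* Take the first member of the flag of [N] that is not contained in [M]: it
   supplements [M], and [N] multiplies it into the previous member. *)
Lemma supersolvable_nilpotent_sqr M N u v : maximal_subalgebra M ->
  SNil_cand N -> u \in N -> v \in N -> u ** v \in M.
Proof.
move=> maxM [[idN [s [c [c0 cs cid cS]]]] nilN] Nu Nv.
have [/subalgebraP algM _ _] := maxM.
have [sNM | nNM] := boolP (N <= M)%VS.
  by rewrite (subvP sNM) //; move/alg_idealP: idN; apply.
have: exists i, (i <= s)%N && ~~ (c i <= M)%VS by exists s; rewrite leqnn cs.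
case/ex_minnP=> [[|k]]; first by rewrite c0 sub0v.
case/andP=> lt_ks nckM min_k.
have sckM : (c k <= M)%VS.
  apply/idPn=> nck; have := min_k k; rewrite ltnn (ltnW lt_ks) nck.
  by move/(_ isT).
have [idk dimk] := cid k (ltnW lt_ks); have [idk1 dimk1] := cid k.+1 lt_ks.
have [sck _] := cS k lt_ks.
have scN : (c k.+1 <= N)%VS by rewrite -cs chain_sub // => i /cS[].
have NckM n w : n \in N -> w \in c k.+1 -> n ** w \in M.
  move=> Nn cw; apply: (subvP sckM).
  by rewrite (nilpotent_chief_factor nilN idk idk1 sck scN) ?dimk ?dimk1.
have decM n : exists2 m, m \in M & exists2 w, w \in c k.+1 & n = m + w.
  by apply/memv_addP; rewrite maximal_add_ideal ?memvf.
have [m Mm [w cw def_u]] := decM u; have [m' Mm' [w' cw' def_v]] := decM v.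
(* With [m] in [N], [NckM] also covers the cross term [m ** w']. *)
have Nm : m \in N by rewrite -(rpredDr m (subvP scN _ cw)) -def_u.
rewrite def_u linearDl /= rpredD //; last by rewrite amulC NckM.
by rewrite def_v linearDr /= rpredD //; [apply: algM | apply: NckM].
Qed.

(** Serves to place the annihilator of the algebra inside the supersolvable nilradical. *)
Lemma SNil_cand_annihilator z : z != 0 -> (forall x, x ** z = 0) ->
  SNil_cand <[z]>%VS.
Proof.
move=> nz_z z0; have idz : alg_ideal <[z]>%VS.
  apply/alg_idealP=> x _ /vlineP[a ->].
  by rewrite linearZr_LR /= z0 scaler0 mem0v.
split; last first.
  exists 2; split=> //; rewrite apowS // big_nat1 apow1.
  apply/abelian_subP=> u v _ /vlineP[a ->].
  by rewrite linearZr_LR /= z0 scaler0.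
split=> //; exists 1%N, (fun i => if i is 0%N then 0%VS else <[z]>%VS).
split=> // [[|[|i]] // _ | [|i] //= _].
- rewrite dimv0; split=> //; apply/alg_idealP=> u v.
  by rewrite !memv0 => /eqP->; rewrite linear0r.
- by rewrite dim_vline nz_z; split.
rewrite sub0v; split=> // z00; move: (memv_line z).
by rewrite -z00 memv0; apply/negP.
Qed.

(** Recognizes a model from a multiplication table: the isomorphism takes coordinates in [b]. *)
Lemma coord_alg_isom n (b : n.-tuple A) (M : 'M[K]_n) : basis_of fullv b ->
    (forall i j, tnth b i ** tnth b j =
       if i == j then \sum_k M i k *: tnth b k else 0) ->
  alg_isom A (mx_evolAlg M).
Proof.
move=> basb bM; pose f u : 'rV[K]_n := \row_i coord b i u.
have f_lin : linear f.
  by move=> a u v; apply/rowP=> i; rewrite !mxE linearP.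
pose fL := GRing.isLinear.Build K A 'rV[K]_n _ f f_lin.
pose F : {linear A -> 'rV[K]_n} := HB.pack f fL.
have decb u : u = \sum_i coord b i u *: tnth b i.
  rewrite {1}(coord_basis basb (memvf u)); apply: eq_bigr => i _.
  by rewrite (tnth_nth 0).
have cb (k : 'I_n -> K) i : coord b i (\sum_j k j *: tnth b j) = k i.
  under eq_bigr do rewrite (tnth_nth 0).
  by rewrite coord_sum_free ?(basis_free basb).
exists F; split.
  exists (fun r : 'rV[K]_n => \sum_i r 0 i *: tnth b i) => [u | r] /=.
    by rewrite {2}(decb u); apply: eq_bigr => i _; rewrite mxE.
  by apply/rowP=> i; rewrite mxE cb.
move=> u v; apply/rowP=> k; rewrite /= /mx_emul !mxE.
rewrite {1}(decb u) {1}(decb v) linear_sumlz linear_sum /=.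
apply: eq_bigr => i _; rewrite !mxE linear_sumr (bigD1 i) //= big1 => [|j nji].
  rewrite addr0 linearZl_LR linearZr_LR /= bM eqxx !linearZ /= cb.
  by rewrite mulrA.
by rewrite linearZl_LR linearZr_LR /= bM eq_sym (negPf nji) !scaler0.
Qed.

End Algebra.

(** Products of elements of [N] lie in every maximal subalgebra, and these meet in 0. *)
Lemma SNil_cand_abelian (K : fieldType) (A : commAlg K) (N : {vspace A}) :
  dually_atomistic A -> {:A}%VS <> 0%VS -> SNil_cand N -> abelian_sub N.
Proof.
move=> daA nzA candN; apply/abelian_subP=> u v Nu Nv; apply/eqP; rewrite -memv0.
apply: dually_atomistic_mem => //; [exact: subalgebra0 | exact/nesym |].
by move=> M maxM _; apply: supersolvable_nilpotent_sqr candN _ _.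
Qed.

(** * Products in a natural basis and abelian ideals of full support *)

Section Evolution.
Variables (K : fieldType) (E : evolAlg K).
Local Notation e := (tnth (nbasis E)).

Lemma evol_coord (u : E) : u = \sum_i coord (nbasis E) i u *: e i.
Proof.
rewrite {1}(coord_basis (nbasisP E) (memvf u)); apply: eq_bigr => i _.
by rewrite (tnth_nth 0).
Qed.

Lemma evol_mulE (u v : E) :
  u ** v = \sum_i (coord (nbasis E) i u * coord (nbasis E) i v) *: (e i ** e i).
Proof.
rewrite {1}(evol_coord u) {1}(evol_coord v) linear_sumlz /=.
apply: eq_bigr => i _; rewrite linear_sumr (bigD1 i) //= big1 => [|j nji].
  by rewrite addr0 linearZl_LR linearZr_LR scalerA.
by rewrite linearZl_LR linearZr_LR /= nbasis_orth 1?eq_sym // !scaler0.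
Qed.

Lemma coord_nbasis i j : coord (nbasis E) i (e j) = (i == j)%:R.
Proof.
by rewrite (tnth_nth 0) coord_free ?(basis_free (nbasisP E)) // eq_sym.
Qed.

Lemma nbasis_mul i (u : E) : e i ** u = coord (nbasis E) i u *: (e i ** e i).
Proof.
rewrite evol_mulE (bigD1 i) //= big1 => [|j nji].
  by rewrite addr0 coord_nbasis eqxx mul1r.
by rewrite coord_nbasis (negPf nji) mul0r scale0r.
Qed.

Lemma supp_sub_fullv i : supp_sub {:E}%VS i.
Proof. by exists (e i); rewrite ?memvf // inE coord_nbasis eqxx oner_eq0. Qed.

Lemma nonabelian_square : ~ abelian_sub {:E}%VS -> exists i, e i ** e i != 0.
Proof.
move=> nabE; have [/existsP // | ] := boolP [exists i, e i ** e i != 0].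
rewrite negb_exists => /forallP sq0; case: nabE; apply/abelian_subP=> u v _ _.
rewrite evol_mulE big1 // => i _.
by rewrite (eqP (negPn (sq0 i))) scaler0.
Qed.

(** Some [e i] with nonzero square acts on [N] as a nonzero scalar; as [e i ** w] is a multiple of
    [e i ** e i], so is each [w] in [N]. *)
Lemma abelian_ideal_full_supp (N : {vspace E}) :
    ~ abelian_sub {:E}%VS -> dually_atomistic E -> alg_ideal N ->
    abelian_sub N -> (forall i, supp_sub N i) ->
  exists y, [/\ y != 0, N = <[y]>%VS & forall u v, u ** v \in N].
Proof.
move=> nabE daE idN abN suppN; have /alg_idealP idN' := idN.
have sqN i : e i ** e i \in N.
  have [u Nu] := suppN i; rewrite inE => nz_ui.
  have := idN' (e i) u Nu; rewrite nbasis_mul.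
  by rewrite rpredZeq (negPf nz_ui).
have [i nz_y] := nonabelian_square nabE.
exists (e i ** e i); split=> //; last first.
  by move=> u v; rewrite evol_mulE rpred_sum // => j _; rewrite rpredZ.
have nN : N <> fullv by move=> defN; apply: nabE; rewrite -defN.
have [c Nc] := abelian_ideal_scalar (e i) daE idN abN nN.
have [u Nu] := suppN i; rewrite inE => nz_ui.
have nz_c : c != 0.
  apply/eqP=> c0; have /eqP := Nc u Nu.
  by rewrite nbasis_mul c0 scale0r scaler_eq0 (negPf nz_ui) (negPf nz_y).
apply/eqP; rewrite eqEsubv -memvE sqN andbT; apply/subvP=> w Nw.
apply/vlineP; exists (c^-1 * coord (nbasis E) i w).
by rewrite -scalerA -nbasis_mul Nc // scalerA mulVf ?scale1r.
Qed.

End Evolution.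

(** * Classification of nonabelian dually atomistic evolution algebras *)

Section DuallyAtomistic.
Variables (K : fieldType) (E : evolAlg K).
Hypotheses (nabE : ~ abelian_sub {:E}%VS) (daE : dually_atomistic E).
Local Notation e := (tnth (nbasis E)).

Let fullv_neq0 : {:E}%VS <> 0%VS.
Proof.
move=> E0; apply: nabE; apply/abelian_subP=> u v.
by rewrite E0 memv0 => /eqP-> _; rewrite linear0l.
Qed.

(* [N = K y] is abelian. A maximal subalgebra [M] without [y] is abelian and
   complements [N], so [y]'s annihilator in [M] annihilates [E]; it lies in
   [N], hence is [0], and has codimension at most one in [M]. *)
Lemma SNil_full_supp_almost_abelian (N : {vspace E}) :
  is_SNil N -> (forall i, supp_sub N i) -> almost_abelian E.
Proof.
move=> [candN maxN] suppN; have abN := SNil_cand_abelian daE fullv_neq0 candN.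
have [[idN _] _] := candN; have /alg_idealP idN' := idN.
have [y [nz_y defN EN]] := abelian_ideal_full_supp nabE daE idN abN suppN.
have Ny : y \in N by rewrite defN memv_line.
split=> //; exists N; split=> //.
have dimN : \dim N = 1%N by rewrite defN dim_vline nz_y.
have lt_NE : (\dim N < \dim {:E})%N.
  rewrite ltn_neqAle dimvS ?subvf // andbT; apply/eqP=> dimNE.
  apply: nabE; suff <- : N = fullv by [].
  by apply/eqP; rewrite eqEdim subvf dimNE leqnn.
have [// | nD] := eqVneq (\dim N).+1 (\dim {:E}).
(* Otherwise [y] is in every maximal subalgebra: one without [y] has dimension at most 1, so [E] has
   dimension at most 2, against [lt_NE] and [nD]. *)
suff: y \in 0%VS by rewrite memv0 (negPf nz_y).
apply: dually_atomistic_mem => //; [exact: subalgebra0 | exact/nesym |].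
move=> M maxM _; have [// | M'y] := boolP (y \in M).
have nNM : ~~ (N <= M)%VS by rewrite defN -memvE.
have MN := maximal_add_ideal maxM idN nNM; have [/subalgebraP algM _ _] := maxM.
have MN0 z : z \in M -> z \in N -> z = 0.
  rewrite {1}defN => Mz /vlineP[a Dz]; move: Mz; rewrite Dz rpredZeq.
  by rewrite (negPf M'y) orbF => /eqP->; rewrite scale0r.
pose L := linfun (amul E y).
have kerM : (M :&: lker L)%VS = 0%VS.
  apply/eqP; rewrite -subv0; apply/subvP=> z.
  rewrite memv_cap memv_ker lfunE /=; case/andP=> Mz /eqP yz0.
  rewrite memv0; apply/negPn/negP=> nz_z.
  have zE x : x ** z = 0.
    have: x \in (M + N)%VS by rewrite MN memvf.
    case/memv_addP=> m Mm [w]; rewrite defN => /vlineP[a ->] ->.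
    rewrite linearDl linearZl_LR /= yz0 scaler0 addr0.
    by apply: MN0; [apply: algM | apply: EN].
  have := maxN _ (SNil_cand_annihilator nz_z zE); rewrite -memvE => Nz.
  by rewrite (MN0 z Mz Nz) eqxx in nz_z.
have dimM : (\dim M <= 1)%N.
  rewrite -(limg_ker_dim L M) kerM dimv0 add0n -dimN dimvS //.
  by apply/subvP=> _ /memv_imgP[u _ ->]; rewrite lfunE EN.
have := leq_trans (dimv_add_leqif M N).1 (leq_add dimM (leqnn _)).
by rewrite MN leqNgt ltn_neqAle add1n nD lt_NE.
Qed.

(* All [e i] are outside [I], hence are scalar multiples of [x + u_i] with
   [u_i] in [I], and then [u_i + u_j = - x ** x] for [i != j] leaves room for
   two indices at most. *)
Lemma almost_abelian_nonsplit_isom (I : {vspace E}) (x : E) :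
    abelian_sub I -> x \notin I -> (I + <[x]>)%VS = fullv ->
    (forall u, u \in I -> x ** u = u) -> I != 0%VS ->
  alg_isom E (E2_1N1 K).
Proof.
move=> /abelian_subP abI I'x Ix actI nzI.
have decI v : exists2 u, u \in I & exists a, v = u + a *: x.
  by apply: mem_addv_line; rewrite Ix memvf.
have nz_e i : e i != 0.
  apply/eqP=> ei0; have /eqP := coord_nbasis i i.
  by rewrite ei0 linear0 eqxx eq_sym oner_eq0.
have I'e i : e i \notin I.
  (* If [e i] is in [I], then [e j ** e i = 0] kills the coefficient of [x] in each other [e j], so
     the whole basis lies in [I]. *)
  apply/negP=> Iei; case/negP: I'x; rewrite (evol_coord x) rpred_sum // => j _.
  rewrite rpredZ //; have [<- // | nij] := eqVneq i j.
  have [u Iu [a Dej]] := decI (e j); rewrite Dej rpredD //.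
  have /eqP : e j ** e i = 0 by rewrite nbasis_orth // eq_sym.
  rewrite Dej linearDl linearZl_LR /= abI // actI // add0r scaler_eq0.
  by rewrite (negPf (nz_e i)) orbF => /eqP->; rewrite scale0r mem0v.
have dec_e i : exists u, u \in I /\ exists a, e i = a *: (x + u).
  have [v Iv [a Dei]] := decI (e i); have nz_a : a != 0.
    by apply: contraNneq (I'e i) => a0; rewrite Dei a0 scale0r addr0.
  exists (a^-1 *: v); split; first by rewrite rpredZ.
  by exists a; rewrite scalerDr scalerA divff // scale1r addrC.
have [u u_e] := fin_all_exists dec_e.
have Iu i : u i \in I by case: (u_e i).
have xuM i j : (x + u i) ** (x + u j) = x ** x + (u i + u j).
  rewrite linearDl !linearDr /= (abI (u i) (u j)) // addr0.
  rewrite -addrA; congr (_ + _).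
  by rewrite (amulC _ x) !actI // addrC.
have sqx i j : i != j -> x ** x = - (u i + u j).
  move=> nij; apply/eqP; rewrite -addr_eq0 -xuM.
  have := nbasis_orth nij; have [_ [a Dei]] := u_e i; have [_ [b Dej]] := u_e j.
  move: (nz_e i) (nz_e j); rewrite Dei Dej !scaler_eq0 !negb_or.
  case/andP=> nz_a _ /andP[nz_b _]; rewrite linearZl_LR linearZr_LR /= scalerA.
  by move/eqP; rewrite scaler_eq0 mulf_eq0 (negPf nz_a) (negPf nz_b).
have edim_gt1 : (1 < edim E)%N.
  rewrite -(size_basis (nbasisP E)) -Ix.
  apply: leq_ltn_trans (_ : \dim I < _)%N.
    by rewrite lt0n dimv_eq0.
  exact: dim_addv_line.
pose i0 := Ordinal (ltnW edim_gt1); pose i1 := Ordinal edim_gt1.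
have only01 i : (i == i0) || (i == i1).
  apply: contraT; rewrite negb_or => /andP[ni0 ni1].
  (* A third index [i] has [u i = u i1], which makes [e i] and [e i1] proportional. *)
  have Dui : u i = u i1.
    apply: (addIr (u i0)); apply: oppr_inj; rewrite -sqx // -sqx //.
  have [_ [a Dei]] := u_e i; have [_ [b De1]] := u_e i1.
  have /eqP := coord_nbasis i i1; rewrite (negPf ni1) De1 -Dui.
  move: (nz_e i1) (coord_nbasis i i); rewrite De1 Dei !linearZ eqxx /=.
  rewrite scaler_eq0 mulf_eq0 => /norP[/negPf-> _] c1 /= /eqP c0.
  by move/eqP: c1; rewrite c0 mulr0 eq_sym oner_eq0.
(* The sign makes the two vectors sum to [u i0 - u i1], which is the square of the first and minus
   the square of the second. *)
pose b := [tuple x + u i0; - (x + u i1)].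
have b_basis : basis_of fullv b.
  rewrite basisEdim size_tuple (size_basis (nbasisP E)) edim_gt1 andbT.
  apply/subvP=> v _; rewrite (evol_coord v) rpred_sum // => i _.
  rewrite rpredZ //; have [_ [a ->]] := u_e i; rewrite rpredZ //.
  case/orP: (only01 i) => /eqP->; first by rewrite memv_span ?mem_head.
  by rewrite -rpredN memv_span // !inE eqxx orbT.
apply: (coord_alg_isom b_basis) => i j; have n01 : i0 != i1 by [].
have sq k l : k != l -> (x + u k) ** (x + u k) = u k - u l.
  by move=> nkl; rewrite xuM (sqx _ _ nkl) opprD addrACA addNr add0r addrC.
have sum_b : tnth b ord0 + tnth b (lift ord0 ord0) = u i0 - u i1.
  by rewrite !(tnth_nth 0) /= opprD addrACA subrr add0r.
have orth_b k l : k != l -> (x + u k) ** (x + u l) = 0.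
  by move=> nkl; rewrite xuM (sqx _ _ nkl) addNr.
case: i j => [[|[|]] // ?] [[|[|]] // ?]; rewrite !(tnth_nth 0) /=.
- by rewrite !big_ord_recl big_ord0 !mxE /= !scale1r addr0 sum_b (sq _ i1).
- by rewrite linearNr /= orth_b ?oppr0.
- by rewrite linearNl /= orth_b ?oppr0 // eq_sym.
rewrite !big_ord_recl big_ord0 !mxE /= !scaleN1r addr0 -opprD sum_b.
by rewrite linearNl linearNr /= opprK (sq _ i0) ?opprB // eq_sym.
Qed.

(** All products are multiples of [x ** x], which lies outside [I]; rescaled, it is an idempotent
    that completes a basis of [I]. *)
Lemma almost_abelian_split_isom (I : {vspace E}) (x : E) :
    alg_ideal I -> abelian_sub I -> x \notin I -> (I + <[x]>)%VS = fullv ->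
    (forall u, u \in I -> x ** u = 0) ->
  alg_isom E (En1 K (\dim I).+1).
Proof.
move=> idI /abelian_subP abI I'x Ix actI.
have decI v : exists2 u, u \in I & exists a, v = u + a *: x.
  by apply: mem_addv_line; rewrite Ix memvf.
have mulE u v a b : u \in I -> v \in I ->
    (u + a *: x) ** (v + b *: x) = (a * b) *: (x ** x).
  move=> Iu Iv; rewrite linearDl !linearDr !linearZr_LR !linearZl_LR /=.
  rewrite (abI u v) // (amulC u) (actI u) // (actI v) // !scaler0 !add0r.
  by rewrite scalerA mulrC.
have nz_sqx : x ** x != 0.
  apply/eqP=> x0; apply: nabE; apply/abelian_subP=> v w _ _.
  have [u Iu [a ->]] := decI v; have [u' Iu' [b ->]] := decI w.
  by rewrite mulE // x0 scaler0.
have [v Iv [a sqx]] := decI (x ** x); have nz_a : a != 0.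
  (* If [x ** x] is in [I], it is in every maximal [M]: either [M = I], or [M] has an element
     [u + b *: x] with [b] nonzero, of square [b ^ 2] times [x ** x]. *)
  apply: contraNneq nz_sqx => a0; rewrite -memv0.
  have Isqx : x ** x \in I by rewrite sqx a0 scale0r addr0.
  apply: dually_atomistic_mem => //; [exact: subalgebra0 | exact/nesym |].
  move=> M [/subalgebraP algM _ maxM] _.
  have [sMI | /subvPn[m Mm]] := boolP (M <= I)%VS.
    have [<- // | fI] := maxM I (ideal_subalgebra idI) sMI.
    by rewrite fI memvf in I'x.
  have [u Iu [b Dm]] := decI m; rewrite Dm rpredDl // rpredZeq negb_or.
  case/andP=> nz_b _; have := algM m m Mm Mm.
  by rewrite Dm mulE // rpredZeq mulf_eq0 (negPf nz_b).
(* This is [a^-2 *: (x ** x)]; only its coefficient [a^-1] at [x] matters for its square, which is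
   therefore [y] again. *)
pose y := a^-2 *: v + a^-1 *: x.
have sqy : y ** y = y.
  rewrite mulE ?rpredZ // sqx scalerDr scalerA /y -exprVn expr2 -mulrA.
  by rewrite mulVf ?mulr1.
have yI u : u \in I -> y ** u = 0.
  by move=> Iu; rewrite linearDl !linearZl_LR /= abI // actI // !scaler0 addr0.
pose b := [tuple of y :: vbasis I].
have b_basis : basis_of fullv b.
  have span_b : {subset y :: vbasis I <= <<b>>%VS} := @memv_span _ _ b.
  have sIb : (I <= <<b>>)%VS.
    by rewrite -{1}(span_basis (vbasisP I)) /= span_cons addvSr.
  rewrite basisEdim size_tuple -Ix subv_add sIb -memvE dim_addv_line //=.
  have : a^-2 *: v + a^-1 *: x \in <<b>>%VS by rewrite memv_span ?mem_head.
  rewrite rpredDl; last by rewrite rpredZ ?(subvP sIb).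
  by rewrite rpredZeq invr_eq0 (negPf nz_a) andbT.
(* Past the end of the list, the default value 0 is also in [I]. *)
have tnth_vbasis k : (vbasis I)`_k \in I.
  have [lt_kI | le_Ik] := ltnP k (\dim I).
    by rewrite vbasis_mem // mem_nth ?size_tuple.
  by rewrite nth_default ?size_tuple ?mem0v.
apply: (coord_alg_isom b_basis) => i j.
under eq_bigr do rewrite mxE.
rewrite big_ord_recl big1 => [|k _]; last by rewrite andbF scale0r.
rewrite andbT addr0 !(tnth_nth 0) /=.
case: i j => [[|i] lti] [[|j] ltj] /=.
- by rewrite sqy scale1r.
- by rewrite yI.
- by rewrite amulC yI.
by rewrite scale0r if_same abI.
Qed.

Lemma almost_abelian_isom : almost_abelian E ->
  alg_isom E (E2_1N1 K) \/ exists n, (0 < n)%N /\ alg_isom E (En1 K n).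
Proof.
case=> _ [I [idI abI dimI]].
have nI : I <> fullv.
  by move=> fI; rewrite -fI in dimI; have := n_Sn (\dim I); rewrite dimI.
have /subvPn[x _ I'x] : ~~ ({:E} <= I)%VS.
  by apply/negP=> sEI; apply: nI; apply/eqP; rewrite eqEsubv subvf.
have Ix : (I + <[x]>)%VS = fullv by apply: addv_line; rewrite ?subvf ?memvf.
have [c actI] := abelian_ideal_scalar x daE idI abI nI.
(* On a zero [I] the scalar [c] carries no information, so this case is treated as split whatever
   [c] is. *)
have [I0 | nzI] := eqVneq I 0%VS.
  right; exists (\dim I).+1; split=> //.
  apply: (almost_abelian_split_isom idI abI I'x Ix).
  by move=> u; rewrite I0 memv0 => /eqP->; rewrite linear0r.
have [c0 | nz_c] := eqVneq c 0.
  right; exists (\dim I).+1; split=> //.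
  apply: (almost_abelian_split_isom idI abI I'x Ix).
  by move=> u Iu; rewrite actI // c0 scale0r.
left; apply: (@almost_abelian_nonsplit_isom I (c^-1 *: x)) => //.
- by rewrite rpredZeq invr_eq0 negb_or nz_c.
- apply: addv_line; rewrite ?subvf ?memvf ?dimI //.
  by rewrite rpredZeq invr_eq0 negb_or nz_c.
by move=> u Iu; rewrite linearZl_LR /= actI // scalerA mulVf ?scale1r.
Qed.

End DuallyAtomistic.

(** * The model algebras: almost abelian and pairwise non-isomorphic *)

Section Models.
Variable K : fieldType.

Lemma E2_1N1_mulE (u v : E2_1N1 K) :
  u ** v = ((u : 'rV_2) 0 0 * (v : 'rV_2) 0 0
            - (u : 'rV_2) 0 1 * (v : 'rV_2) 0 1) *: (const_mx 1 : 'rV[K]_2).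
Proof.
rewrite /= /mx_emul; apply/rowP=> j.
rewrite !mxE !big_ord_recl big_ord0 !mxE /=.
have -> : lift ord0 ord0 = 1 :> 'I_2 by apply/val_inj.
by rewrite addr0 mulrN !mulr1.
Qed.

Lemma En1_mulE n (u v : En1 K n.+1) :
  u ** v = ((u : 'rV_n.+1) 0 0 * (v : 'rV_n.+1) 0 0) *:
             (delta_mx 0 0 : 'rV[K]_n.+1).
Proof.
rewrite /= /mx_emul; apply/rowP=> j; rewrite !mxE big_ord_recl big1 => [|i _].
  by rewrite !mxE /= addr0.
by rewrite !mxE /= mulr0.
Qed.

(** The abelian ideal is the diagonal line, which contains all products and whose generator has
    square 0. *)
Lemma almost_abelian_E2_1N1 : almost_abelian (E2_1N1 K).
Proof.
pose d : E2_1N1 K := (const_mx 1 : 'rV[K]_2).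
have nz_d : d != 0.
  by apply/eqP=> /rowP/(_ 0)/eqP; rewrite !mxE oner_eq0.
split=> [/abelian_subP ab|].
  pose e0 : E2_1N1 K := (delta_mx 0 0 : 'rV[K]_2).
  have /eqP := ab e0 e0 (memvf _) (memvf _).
  by rewrite E2_1N1_mulE !mxE /= mul1r mul0r subr0 scale1r (negPf nz_d).
exists <[d]>%VS; split.
- apply/alg_idealP=> u v _; rewrite E2_1N1_mulE; apply: memvZ; exact: memv_line.
- apply/abelian_subP=> _ _ /vlineP[a ->] /vlineP[b ->].
  by rewrite linearZl_LR linearZr_LR /= E2_1N1_mulE !mxE subrr scale0r !scaler0.
by rewrite dim_vline nz_d dimvf.
Qed.

(** The abelian ideal is the kernel of multiplication by the idempotent [e0], that is, the
    hyperplane where the first coordinate vanishes. *)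
Lemma almost_abelian_En1 n : (0 < n)%N -> almost_abelian (En1 K n).
Proof.
case: n => // n _; pose e0 : En1 K n.+1 := (delta_mx 0 0 : 'rV[K]_n.+1).
have nz_e0 : e0 != 0.
  by apply/eqP=> /rowP/(_ 0)/eqP; rewrite !mxE oner_eq0.
have sqe0 : e0 ** e0 = e0 by rewrite En1_mulE !mxE mul1r scale1r.
split=> [/abelian_subP ab|].
  by have /eqP := ab e0 e0 (memvf _) (memvf _); rewrite sqe0 (negPf nz_e0).
pose L := linfun (amul (En1 K n.+1) e0).
have kerL u : (u \in lker L) = ((u : 'rV_n.+1) 0 0 == 0).
  rewrite memv_ker lfunE /= En1_mulE scaler_eq0 (negPf nz_e0) orbF.
  by rewrite !mxE mul1r.
exists (lker L); split.
- apply/alg_idealP=> u v; rewrite !kerL En1_mulE => /eqP->.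
  by rewrite mulr0 scale0r mxE.
- apply/abelian_subP=> u v; rewrite !kerL En1_mulE => /eqP->.
  by rewrite mul0r scale0r.
rewrite -(limg_ker_dim L fullv) capfv (_ : limg L = <[e0]>%VS).
  by rewrite dim_vline nz_e0 addn1.
apply/eqP; rewrite eqEsubv -memvE; apply/andP; split.
  apply/subvP=> _ /memv_imgP[u _ ->]; rewrite lfunE /= En1_mulE.
  by apply: memvZ; exact: memv_line.
by rewrite -sqe0 -[e0 ** e0](lfunE (amul (En1 K n.+1) e0)) memv_img ?memvf.
Qed.

Lemma alg_isom_dim (A B : commAlg K) : alg_isom A B -> \dim {:A} = \dim {:B}.
Proof.
case=> f [[g fK gK] _]; pose F := linfun f.
have kerF : lker F = 0%VS.
  apply/eqP; rewrite -subv0; apply/subvP=> u; rewrite memv_ker lfunE /= memv0.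
  by move/eqP=> fu0; rewrite -(fK u) fu0 -(linear0 f) fK.
rewrite -(limg_ker_dim F fullv) kerF capv0 dimv0 add0n; congr (\dim _).
apply/eqP; rewrite eqEsubv subvf; apply/subvP=> v _.
by rewrite -(gK v) -[f _]lfunE memv_img ?memvf.
Qed.

(** Idempotents separate the two: [e0] is a nonzero one, while in [E2_1N1 K] every product is a
    multiple of a vector of square 0. *)
Lemma E2_1N1_not_isom_En1 n : (0 < n)%N -> ~ alg_isom (E2_1N1 K) (En1 K n).
Proof.
case: n => // n _ [f [[g fK gK] fM]].
pose e0 : En1 K n.+1 := (delta_mx 0 0 : 'rV[K]_n.+1).
have nz_e0 : e0 != 0.
  by apply/eqP=> /rowP/(_ 0)/eqP; rewrite !mxE oner_eq0.
have sqe0 : e0 ** e0 = e0 by rewrite En1_mulE !mxE mul1r scale1r.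
have sqg : g e0 ** g e0 = g e0 by rewrite -[LHS]fK fM gK sqe0.
have g0 : g e0 = 0.
  move: sqg; rewrite E2_1N1_mulE; set c := (_ - _) => Dg.
  have: c = 0 by rewrite /c -Dg !mxE subrr.
  by move=> c0; rewrite -Dg c0 scale0r.
by case/eqP: nz_e0; rewrite -(gK e0) g0 linear0.
Qed.

Lemma En1_isom_eq m n : alg_isom (En1 K m) (En1 K n) -> m = n.
Proof. by move/alg_isom_dim; rewrite !dimvf /dim /= !mul1n. Qed.

End Models.

Theorem theorem5p3 (K : fieldType) (charK : 2%N \notin [pchar K]) :
  (forall E : evolAlg K,
     ~ abelian_sub {:E}%VS ->
     almost_abelian E \/
       (exists2 N : {vspace E}, is_SNil N &
          forall i, supp_sub N i <-> supp_sub {:E}%VS i) ->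
     dually_atomistic E ->
     alg_isom E (E2_1N1 K) \/
       (exists n : nat, (0 < n)%N /\ alg_isom E (En1 K n)))
  /\ [/\ almost_abelian (E2_1N1 K),
         forall n : nat, (0 < n)%N -> almost_abelian (En1 K n),
         forall n : nat, (0 < n)%N -> ~ alg_isom (E2_1N1 K) (En1 K n)
       & forall m n : nat, (0 < m)%N -> (0 < n)%N -> m <> n ->
           ~ alg_isom (En1 K m) (En1 K n)].
Proof.
split=> [E nabE aaE daE | ].
  apply: almost_abelian_isom => //; case: aaE => // -[N SNilN suppN].
  apply: SNil_full_supp_almost_abelian SNilN _ => // i.
  by apply/suppN; apply: supp_sub_fullv.
split; [exact: almost_abelian_E2_1N1 | exact: almost_abelian_En1
       | exact: E2_1N1_not_isom_En1 |].
by move=> m n _ _ nmn /En1_isom_eq.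
Qed.
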